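(* Let $G$ be a connected bipartite graph on $n\geq 5$ vertices and let $k$ be an integer with $2\leq k\leq \lceil \frac{n}{2}\rceil$. Then $T_k(G)$ is not well-covered.
   Context: For a graph $G$ with vertex set $V$ of size $n$ and $1\le k\le n-1$, the $k$-token graph $T_k(G)$ has as vertices the $k$-subsets of $V$, two of them adjacent if their symmetric difference is an edge of $G$. A graph is well-covered if all of its maximal (with respect to inclusion) independent sets have the same cardinality. *)

(* Defs.v *)
From mathcomp Require Import all_boot.

Set Implicit Arguments.
Unset Strict Implicit.
Unset Printing Implicit Defensive.

Record sgraph := SGraph {
  vertex :> finType;
  edge : rel vertex;
  edge_sym : symmetric edge;
  edge_irrefl : irreflexive edge
}.

(* The null graph is excluded from the connected graphs. *)
Definition connected_graph (G : sgraph) : Prop :=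
  0 < #|G| /\ forall x y : G, connect (@edge G) x y.

(* The parts A and B may be empty. *)
Definition bipartite (G : sgraph) : Prop :=
  exists A B : {set G},
    [/\ A :|: B = [set: G], [disjoint A & B] &
        forall x y : G, edge x y ->
          (x \in A) && (y \in B) || (x \in B) && (y \in A)].

Definition independent (G : sgraph) (S : {set G}) : bool :=
  [forall x in S, forall y in S, ~~ edge x y].

Definition well_covered (G : sgraph) : Prop :=
  forall S1 S2 : {set G},
    maxset (@independent G) S1 -> maxset (@independent G) S2 -> #|S1| = #|S2|.

Section TokenGraph.
Variables (G : sgraph) (k : nat).

Definition token_vertex : finType := {A : {set G} | #|A| == k}.

Definition symdiff (A B : {set G}) : {set G} := (A :\: B) :|: (B :\: A).

Definition token_edge : rel token_vertex := fun A B =>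
  [exists x : G, exists y : G,
     edge x y && (symdiff (val A) (val B) == [set x; y])].

Lemma token_edge_sym : symmetric token_edge.
Proof. by move=> A B; rewrite /token_edge /symdiff setUC. Qed.

Lemma token_edge_irrefl : irreflexive token_edge.
Proof.
move=> A; apply/existsP => -[x /existsP[y /andP[_ /eqP]]].
by rewrite /symdiff setDv setU0 => /setP/(_ x); rewrite !inE eqxx.
Qed.

Definition token_graph : sgraph := SGraph token_edge_sym token_edge_irrefl.

End TokenGraph.

(* Main.v *)
Require Import Defs.
From mathcomp Require Import all_boot zify.

(* A well-covered bipartite graph without isolated vertices satisfies Hall's
   condition, since S together with the non-neighbours of S on the other side is
   independent; so it has a perfect matching. Each maximal independent set then
   meets every matching edge exactly once, which forces, for a matching edge xy,
   every neighbour of x to be adjacent to every neighbour of y (Ravindra).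
   The token graph is bipartite, so it suffices to find a k-set S for which no
   move a -> b has this property: a move c -> d from S and a move c' -> d' from
   the set reached by a -> b must lead to non-adjacent sets. If G contains a path
   v1 ... v5, take S separating {v2, v4} from {v1, v3, v5}; this needs only
   2 <= k <= n - 2. Otherwise G is a star or a double star, and S consists of
   leaves, with the same centre when k = 2. *)

Set Implicit Arguments.
Unset Strict Implicit.
Unset Printing Implicit Defensive.

(** * Sets of prescribed size *)

Lemma exists_subset_card (T : finType) (X Z : {set T}) (k : nat) :
  X \subset Z -> #|X| <= k <= #|Z| ->
  exists S : {set T}, [/\ X \subset S, S \subset Z & #|S| = k].
Proof.
move=> sXZ /andP[leXk lekZ].
pose s := take (k - #|X|) (enum (Z :\: X)).
have sub_s z : z \in s -> z \in Z :\: X by move/mem_take; rewrite mem_enum.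
have us : uniq s by rewrite take_uniq ?enum_uniq.
exists (X :|: [set z in s]); split; first exact: subsetUl.
  rewrite subUset sXZ; apply/subsetP => z; rewrite inE => /sub_s.
  by case/setDP.
rewrite cardsU (_ : X :&: _ = set0); last first.
  apply/setP=> z; rewrite !inE; apply/negbTE/andP=> -[zX /sub_s].
  by rewrite inE zX.
rewrite cards0 subn0 cardsE (card_uniqP us) size_takel ?subnKC //.
by rewrite -cardE cardsD (setIidPr sXZ) leq_sub2r.
Qed.

Lemma exists_separating_set_card (T : finType) (X Y : {set T}) (k : nat) :
  [disjoint X & Y] -> #|X| <= k -> k + #|Y| <= #|T| ->
  exists2 S : {set T}, #|S| = k &
    {in X, forall z, z \in S} /\ {in Y, forall z, z \notin S}.
Proof.
rewrite disjoints_subset => sXY leXk leYT.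
have [|S [/subsetP sXS /subsetP sSY cS]] := @exists_subset_card _ _ _ k sXY.
  by rewrite leXk; have := cardsC Y; lia.
by exists S => //; split=> // z Yz; apply: contraL Yz => /sSY; rewrite inE.
Qed.

(** * Hall's marriage theorem *)

Section Hall.
Variables (X Y : finType).
Implicit Types (N : X -> {set Y}) (D : {set X}).

(** Induction on [#|D|], according to whether some nonempty proper subset of [D] is tight, that is,
    has exactly as many neighbours as elements. The value [y0] serves for the total function [f]
    when [D] is empty. *)
Theorem Hall_marriage N D (y0 : Y) :
  (forall S : {set X}, S \subset D -> #|S| <= #|\bigcup_(x in S) N x|) ->
  exists f : X -> Y, {in D &, injective f} /\ {in D, forall x, f x \in N x}.
Proof.
have [m] := ubnP #|D|; elim: m => // m IHm in N D *; rewrite ltnS => leDm hall.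
have [->|[x0 Dx0]] := set_0Vmem D.
  by exists (fun=> y0); split=> x; rewrite inE.
(* A tight [S] is matched inside its neighbourhood [NS], and the rest of [D] outside [NS]. Hall's
   condition for the rest comes from [hall] at [S' :|: S] after cancelling [#|NS| = #|S|]. *)
have [/existsP[S /and4P[sSD S0 neSD /eqP tight]]|] :=
  boolP [exists S : {set X}, [&& S \subset D, S != set0, S != D
                              & #|\bigcup_(x in S) N x| == #|S|]].
  have ltSD : #|S| < #|D| by rewrite proper_card // properEneq neSD.
  have [||f [f_inj fN]] := IHm N S.
  - exact: leq_trans ltSD leDm.
  - by move=> S' sS'; apply: hall; apply: subset_trans sSD.
  pose NS := \bigcup_(x in S) N x.
  have [||g [g_inj gN]] := IHm (fun x => N x :\: NS) (D :\: S).
  - move: S0; rewrite -card_gt0 cardsD (setIidPr sSD); lia.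
  - move=> S' sS'; have disj : S' :&: S = set0.
      apply/setP=> x; rewrite !inE; apply/negbTE/andP=> -[/(subsetP sS')].
      by rewrite inE => /andP[/negbTE->].
    have := hall (S' :|: S); rewrite subUset sSD.
    rewrite (subset_trans sS' (subsetDl _ _)) => /(_ isT).
    rewrite cardsU disj cards0 subn0 -tight -/NS => le1.
    rewrite -(leq_add2r #|NS|); apply: leq_trans le1 _.
    apply: leq_trans (leq_card_setU _ _); apply: subset_leq_card.
    apply/subsetP=> y /bigcupP[x]; rewrite inE orbC inE => Sx xy.
    have [//|/= NSy] := boolP (y \in NS); first by rewrite orbT.
    rewrite orbF; apply/bigcupP; exists x; last by rewrite inE NSy.
    case/orP: Sx => // Sx; case/negP: NSy.
    by apply/bigcupP; exists x.
  exists (fun x => if x \in S then f x else g x).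
  have fNS x : x \in S -> f x \in NS.
    by move=> Sx; apply/bigcupP; exists x => //; apply: fN.
  have gNS x : x \in D -> x \notin S -> g x \notin NS.
    by move=> Dx Sx; have := gN x; rewrite !inE Sx Dx => /(_ isT)/andP[].
  split=> [x y Dx Dy|x Dx]; last first.
    have [Sx|Sx] := boolP (x \in S); first exact: fN.
    by have := gN x; rewrite !inE Sx Dx => /(_ isT)/andP[].
  have [Sx|Sx] := boolP (x \in S); have [Sy|Sy] := boolP (y \in S) => //.
  - exact: f_inj.
  - by move=> e; have := gNS y Dy Sy; rewrite -e fNS.
  - by move=> e; have := gNS x Dx Sx; rewrite e fNS.
  - by apply: g_inj; rewrite inE ?Sx ?Sy.
(* Without tight sets each nonempty proper subset has a spare neighbour, so [x0] may take any
   neighbour [y1]. *)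
rewrite negb_exists => /forallP loose.
have [y1 Ny1] : exists y1, y1 \in N x0.
  apply/set0Pn; rewrite -card_gt0.
  by have := hall [set x0]; rewrite sub1set cards1 big_set1; apply.
have [||g [g_inj gN]] := IHm (fun x => N x :\ y1) (D :\ x0).
- by have := cardsD1 x0 D; rewrite Dx0; lia.
- move=> S sS; have [->|S0] := eqVneq S set0; first by rewrite cards0.
  have [sSD Sx0] := subsetD1P sS.
  have neSD : S != D by apply: contraNneq Sx0 => ->.
  have := loose S; rewrite sSD S0 neSD /= => ne.
  have lt : #|S| < #|\bigcup_(x in S) N x| by rewrite ltn_neqAle eq_sym ne hall.
  rewrite -ltnS; apply: leq_trans lt _.
  rewrite -add1n -(cards1 y1); apply: leq_trans (leq_card_setU _ _).
  apply: subset_leq_card; apply/subsetP=> y /bigcupP[x Sx xy].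
  rewrite !inE; have [//|ne1 /=] := eqVneq y y1.
  by apply/bigcupP; exists x => //; rewrite !inE ne1.
exists (fun x => if x == x0 then y1 else g x).
have gy1 x : x \in D -> x != x0 -> g x \in N x :\ y1.
  by move=> Dx nx; apply: gN; rewrite !inE nx.
split=> [x y Dx Dy|x Dx]; last first.
  have [->//|nx] := eqVneq x x0.
  by have := gy1 x Dx nx; rewrite !inE => /andP[].
have [->|nx] := eqVneq x x0; have [->|ny] := eqVneq y x0 => //.
- by move=> e; have := gy1 y Dy ny; rewrite -e !inE eqxx.
- by move=> e; have := gy1 x Dx nx; rewrite e !inE eqxx.
- by apply: g_inj; rewrite !inE ?nx ?ny.
Qed.
End Hall.

Lemma independentP (G : sgraph) (S : {set G}) :
  reflect {in S &, forall x y, ~~ edge x y} (independent S).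
Proof.
apply: (iffP forall_inP) => [h x y Sx Sy|h x Sx].
  by have /forall_inP := h x Sx; apply.
by apply/forall_inP => y; apply: h.
Qed.

(** * Perfect matchings in well-covered bipartite graphs *)

Section Ravindra.
Variable H : sgraph.
Hypothesis no_isolated : forall x : H, exists y, edge x y.
Hypothesis wcH : well_covered H.

(** One part determines the other, its complement; this makes the two sides interchangeable by
    [bipartitionC]. *)
Definition bipartition (A : {set H}) : Prop :=
  forall x y : H, edge x y -> (x \in A) != (y \in A).

Lemma bipartitionC (A : {set H}) : bipartition A -> bipartition (~: A).
Proof. by move=> bA x y /bA; rewrite !inE; do 2!case: (_ \in _). Qed.

(** A vertex outside [A] has a neighbour, which lies in [A], so it cannot be added. *)
Lemma bipartition_maxset (A : {set H}) :
  bipartition A -> maxset (@independent H) A.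
Proof.
move=> bA; apply/maxsetP; split=> [|B /independentP indB sAB].
  by apply/independentP=> x y Ax Ay; apply/negP=> /bA; rewrite Ax Ay.
apply/eqP; rewrite eqEsubset sAB andbT; apply/subsetP=> x Bx.
have [//|Ax] := boolP (x \in A); have [y xy] := no_isolated x.
have Ay : y \in A by have := bA x y xy; rewrite (negbTE Ax); case: (y \in A).
by have := indB x y Bx (subsetP sAB y Ay); rewrite xy.
Qed.

Lemma maximal_independent_card (A S : {set H}) :
  bipartition A -> maxset (@independent H) S -> #|S| = #|A|.
Proof. by move=> bA mS; apply: wcH => //; apply: bipartition_maxset. Qed.

Lemma independent_card_le (A S : {set H}) :
  bipartition A -> independent S -> #|S| <= #|A|.
Proof.
move=> bA /maxset_exists[B mB sSB].
by rewrite -(maximal_independent_card bA mB) subset_leq_card.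
Qed.

Lemma well_covered_matching (A : {set H}) : bipartition A ->
  exists f : H -> H, {in A &, injective f} /\ {in A, forall x, edge x (f x)}.
Proof.
move=> bA; pose N x := [set y : H | edge x y].
have [->|[x0 _]] := set_0Vmem A.
  by exists id; split=> x; rewrite inE.
have [|f [f_inj fN]] := @Hall_marriage H H N A x0.
  move=> S sSA; set NS := \bigcup_(x in S) N x.
  have sN : NS \subset ~: A.
    apply/subsetP=> y /bigcupP[x Sx]; rewrite !inE => /bA.
    by rewrite (subsetP sSA x Sx); case: (y \in A).
  have disj : S :&: (~: A :\: NS) = set0.
    apply/setP=> x; rewrite !inE; apply/negbTE/andP=> -[Sx].
    by rewrite (subsetP sSA x Sx) andbF.
  have ind : independent (S :|: (~: A :\: NS)).
    have NSP x y : x \in S -> y \in ~: A :\: NS -> ~~ edge x y.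
      move=> Sx /setDP[_]; apply: contra => xy.
      by apply/bigcupP; exists x; rewrite ?inE.
    apply/independentP=> x y /setUP[Sx|Tx] /setUP[Sy|Ty].
    - by apply/negP=> /bA; rewrite !(subsetP sSA).
    - exact: NSP.
    - by rewrite edge_sym NSP.
    - apply/negP=> /bA; move: Tx Ty; rewrite !inE.
      by move=> /andP[_ /negbTE->] /andP[_ /negbTE->].
  (* The bound [#|S| + #|~: A| - #|NS| <= #|~: A|] is Hall's condition for [S]. *)
  have := independent_card_le (bipartitionC bA) ind.
  rewrite cardsU disj cards0 subn0 cardsD (setIidPr sN).
  have := subset_leq_card sN; lia.
by exists f; split=> // x Ax; have := fN x Ax; rewrite inE.
Qed.

(** The witness is the partner of [x] in the matching. If [x'] and [y'] were not adjacent, a maximal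
    independent set containing both would miss both ends of that matching edge and be too small. *)
Lemma well_covered_joined_neighbour (A : {set H}) (x : H) : bipartition A ->
  exists2 y, edge x y &
    forall x' y', edge y x' -> edge x y' -> edge x' y'.
Proof.
wlog Ax : A / x \in A.
  move=> wl bA; have [Ax|Ax] := boolP (x \in A); first exact: wl Ax bA.
  by apply: (wl (~: A)); rewrite ?inE //; apply: bipartitionC.
move=> bA; have [f [f_inj fE]] := well_covered_matching bA.
exists (f x) => [|x' y' yx' xy']; first exact: fE.
apply/negPn/negP=> nx'y'.
have ind : independent [set x'; y'].
  apply/independentP=> u v /set2P[]-> /set2P[]->; rewrite ?edge_irrefl //.
  by rewrite edge_sym.
have [S mS sS] := maxset_exists ind.
have /independentP indS := maxsetp mS.
(* S meets every edge of the matching at most once, and misses the one at x,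
   so it has fewer than #|A| elements. *)
have Sx : x \notin S.
  apply/negP=> Sx; have := indS x y' Sx.
  by rewrite xy' (subsetP sS) ?set22 // => /(_ isT).
have Sfx : f x \notin S.
  apply/negP=> Sx'; have := indS (f x) x' Sx'.
  by rewrite yx' (subsetP sS) ?set21 // => /(_ isT).
have fA u : u \in A -> f u \notin A.
  by move=> Au; have := bA _ _ (fE u Au); rewrite Au; case: (f u \in A).
(* Both sides are maximal independent sets, hence of equal size, so the matching is perfect. *)
have imf : f @: A = ~: A.
  apply/eqP; rewrite eqEcard (card_in_imset f_inj).
  rewrite (maximal_independent_card bA (bipartition_maxset (bipartitionC bA))).
  rewrite leqnn andbT; apply/subsetP=> _ /imsetP[u Au ->].
  by rewrite inE fA.
(* The ends in [A] of the matching edges that [S] meets; [x] is not among them. *)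
pose T := [set u in A | (u \in S) || (f u \in S)].
have : #|T| < #|A|.
  apply: proper_card; apply/properP; split.
    by apply/subsetP=> u; rewrite inE => /andP[].
  by exists x => //; rewrite inE Ax (negbTE Sx) (negbTE Sfx).
rewrite -(maximal_independent_card bA mS) ltnNge => /negP; apply.
(* [h] sends a vertex to the end in [A] of its matching edge. By [imf] the search succeeds for every
   [u] outside [A], so the default is never taken there. Independence of [S] makes [h] injective on
   [S]. *)
pose h u := if u \in A then u else odflt u [pick v in A | f v == u].
have hP u : u \notin A -> (h u \in A) && (f (h u) == u).
  move=> Au; rewrite /h (negbTE Au); case: pickP => [v //|none].
  have : u \in f @: A by rewrite imf inE.
  by case/imsetP=> v Av e; have := none v; rewrite /= Av e eqxx.
have hA u : u \in A -> h u = u by rewrite /h => ->.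
rewrite -(card_in_imset (f := h) (D := S)); last first.
  move=> u v Su Sv; have [Au|Au] := boolP (u \in A);
    have [Av|Av] := boolP (v \in A).
  - by rewrite !hA.
  - rewrite hA // => e; have /andP[_ /eqP ev] := hP v Av.
    by have := indS u v Su Sv; rewrite -ev -e fE.
  - rewrite (hA v) // => e; have /andP[_ /eqP eu] := hP u Au.
    by have := indS v u Sv Su; rewrite -eu e fE.
  - have /andP[_ /eqP eu] := hP u Au; have /andP[_ /eqP ev] := hP v Av.
    by move=> e; rewrite -eu -ev e.
apply: subset_leq_card; apply/subsetP=> _ /imsetP[u Su ->].
have [Au|Au] := boolP (u \in A); first by rewrite hA // inE Au Su.
by have /andP[hu /eqP e] := hP u Au; rewrite inE hu e Su orbT.
Qed.

End Ravindra.

(** * Token moves *)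

Section Token.
Variable G : sgraph.
Implicit Types (S : {set G}) (a b c d u v w x y z : G).

(** A legal move of a token along the edge, in whichever direction is possible. *)
Definition cut S a b : bool := edge a b && ((a \in S) != (b \in S)).

(** Written as a symmetric difference, a move does not depend on its direction, and membership after
    several moves is a sum modulo 2. *)
Definition slide S a b : {set G} := symdiff S [set a; b].

Lemma in_slide S a b t :
  (t \in slide S a b) = (t \in S) (+) ((t == a) || (t == b)).
Proof.
by rewrite /slide /symdiff !inE; case: (t \in S); case: (t == a); case: (t == b).
Qed.

Lemma slideC S a b : slide S a b = slide S b a.
Proof. by rewrite /slide setUC. Qed.

Lemma cutC S a b : cut S a b = cut S b a.
Proof. by rewrite /cut edge_sym eq_sym. Qed.

Lemma slideE S a b : a \in S -> b \notin S -> slide S a b = b |: (S :\ a).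
Proof.
move=> Sa Sb; apply/setP=> t; rewrite in_slide !inE.
have ab : a != b by apply: contraNneq Sb => <-.
have [->|_] := eqVneq t a; first by rewrite Sa (negbTE ab).
by have [->|_] := eqVneq t b; rewrite ?(negbTE Sb) // addbF.
Qed.

Lemma cutP S a b : cut S a b ->
  exists u v, [/\ edge u v, u \in S, v \notin S & slide S a b = slide S u v].
Proof.
case/andP=> eab; have [Sa|Sa] := boolP (a \in S);
  have [Sb|Sb] := boolP (b \in S) => // _.
  by exists a, b.
by exists b, a; rewrite edge_sym slideC.
Qed.

Lemma card_slide S a b : cut S a b -> #|slide S a b| = #|S|.
Proof.
case/cutP=> u [v [_ Su Sv ->]]; rewrite slideE //.
by rewrite cardsU1 !inE (negbTE Sv) andbF (cardsD1 u S) Su.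
Qed.

(** Otherwise [S] would be closed under adjacency and contain every vertex. *)
Lemma connected_cut S : connected_graph G -> S != set0 -> S != setT ->
  exists a b, [/\ edge a b, a \in S & b \notin S].
Proof.
move=> [_ conn] /set0Pn[a0 Sa0] /eqP neT.
have [/existsP[a /existsP[b /and3P[]]]|] :=
  boolP [exists a, exists b, [&& edge a b, a \in S & b \notin S]].
  by exists a, b.
rewrite negb_exists => /forallP none; case: neT; apply/setP=> z.
rewrite inE; have := conn a0 z.
have cl : closed (@edge G) (mem S).
  apply: intro_closed => [|a b ab Sa]; first exact/sym_connect_sym/edge_sym.
  have := none a; rewrite negb_exists => /forallP/(_ b).
  by rewrite ab Sa /= negbK.
by move/(closed_connect cl) => <-.
Qed.

(** * Bipartite graphs without a path on five vertices *)

Lemma bipartite_bipartition : bipartite G -> exists A : {set G}, bipartition A.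
Proof.
case=> X [Y [_ dXY bXY]]; exists X => x y /bXY/orP[]/andP[u v].
  by rewrite u (disjointFl dXY v).
by rewrite v (disjointFl dXY u).
Qed.

Lemma bipartite_triangle_free a b c :
  bipartite G -> edge a b -> edge b c -> ~~ edge a c.
Proof.
move=> /bipartite_bipartition[A bA] /bA ab /bA bc; apply/negP=> /bA; move: ab bc.
by do 3!case: (_ \in A).
Qed.

Lemma edge_neq a b : edge a b -> a != b.
Proof. by apply: contraTneq => ->; rewrite edge_irrefl. Qed.

(** For a connected bipartite graph this describes a star or a double star: every other vertex is a
    leaf at [x] or at [y]. *)
Definition dominating_edge x y : Prop :=
  edge x y /\ forall u v, edge u v -> (u \in [set x; y]) || (v \in [set x; y]).

Lemma dominating_edgeC x y : dominating_edge x y -> dominating_edge y x.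
Proof. by case=> xy dom; split; rewrite 1?edge_sym // setUC. Qed.

(** The closed neighbourhood [N] of the edge has no edge leaving it, so by connectedness it is the
    whole graph. *)
Lemma closed_dominating_edge x y : connected_graph G -> edge x y ->
  (forall w z, edge x w || edge y w -> w \notin [set x; y] -> edge w z ->
     z \in [set x; y]) ->
  dominating_edge x y.
Proof.
move=> conn xy cl; pose N := [set w | edge x w || edge y w].
have sN z : z \in [set x; y] -> z \in N.
  by case/set2P=> ->; rewrite !inE ?xy // edge_sym xy orbT.
have NT : N = setT.
  apply/eqP/negPn/negP=> neT.
  have [|a [b [ab Na Nb]]] := connected_cut conn _ neT.
    by apply/set0Pn; exists x; apply: sN; rewrite set21.
  have [/set2P[]e|na] := boolP (a \in [set x; y]).
  - by move: Nb; rewrite inE -e ab.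
  - by move: Nb; rewrite inE -e ab orbT.
  by case/negP: Nb; apply: sN; apply: cl na ab; move: Na; rewrite inE.
split=> // u v uv; case: (boolP (u \in _)) => //= nu; apply: cl nu uv.
by have := in_setT u; rewrite -NT inE.
Qed.

Lemma path5_or_dominating_edge :
  connected_graph G -> bipartite G -> 4 < #|G| ->
  (exists v1 v2 v3 v4 v5, uniq [:: v1; v2; v3; v4; v5] /\
     [/\ edge v1 v2, edge v2 v3, edge v3 v4 & edge v4 v5]) \/
  (exists x y, dominating_edge x y).
Proof.
move=> conn bip n5.
pose P5 v1 v2 v3 v4 v5 := uniq [:: v1; v2; v3; v4; v5] &&
   [&& edge v1 v2, edge v2 v3, edge v3 v4 & edge v4 v5].
have [|no] := boolP [exists v1, exists v2, exists v3, exists v4, exists v5,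
                       P5 v1 v2 v3 v4 v5].
  case/existsP=> v1 /existsP[v2 /existsP[v3 /existsP[v4 /existsP[v5]]]].
  by case/andP=> u5 /and4P[]; left; exists v1, v2, v3, v4, v5.
right; have [A bA] := bipartite_bipartition bip.
have diff a b : (a \in A) != (b \in A) -> a != b by apply: contraNneq => ->.
(* Vertices three steps apart on the walk lie on different sides, so only the inequalities at even
   distance have to be supplied. *)
have noP5 v1 v2 v3 v4 v5 : edge v1 v2 -> edge v2 v3 -> edge v3 v4 ->
    edge v4 v5 -> v1 != v3 -> v1 != v5 -> v3 != v5 -> v2 != v4 -> False.
  move=> e12 e23 e34 e45 n13 n15 n35 n24; case/negP: no.
  apply/existsP; exists v1; apply/existsP; exists v2; apply/existsP; exists v3.
  apply/existsP; exists v4; apply/existsP; exists v5.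
  have n14 : v1 != v4.
    apply: diff; move: (bA _ _ e12) (bA _ _ e23) (bA _ _ e34).
    by do 4!case: (_ \in A).
  have n25 : v2 != v5.
    apply: diff; move: (bA _ _ e23) (bA _ _ e34) (bA _ _ e45).
    by do 4!case: (_ \in A).
  rewrite /P5 e12 e23 e34 e45 /= !inE !negb_or n13 n14 n15 n24 n25 n35.
  by rewrite (edge_neq e12) (edge_neq e23) (edge_neq e34) (edge_neq e45).
(* As there are at least five vertices, some vertex [b] is attached to the 4-cycle; going from [b]
   around the cycle gives a path on five vertices. *)
have noC4 u x y v : edge u x -> edge x y -> edge y v -> edge u v ->
    u != y -> x != v -> False.
  move=> ux xy yv uv nuy nxv; pose S := [set u; x; y; v].
  have cS : #|S| <= 4.
    rewrite /S; do 3!(rewrite setUC cardsU1); rewrite cards1.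
    by do 3!case: (_ \notin _).
  have [||a [b [ab]]] := @connected_cut S conn.
  - by apply/set0Pn; exists u; rewrite !inE eqxx.
  - by apply/eqP=> e; move: n5; rewrite -cardsT -e ltnNge cS.
  rewrite !inE => Sa /norP[/norP[/norP[bu bx] bY] bv].
  have nyu : y != u by rewrite eq_sym.
  have nvx : v != x by rewrite eq_sym.
  move: Sa; rewrite -!orbA => /or4P[]/eqP e; move: ab; rewrite e edge_sym => ba.
  - by apply: (noP5 b u x y v).
  - by apply: (noP5 b x y v u); rewrite // edge_sym.
  - by apply: (noP5 b y v u x); rewrite // edge_sym.
  - by apply: (noP5 b v u x y); rewrite // edge_sym.
(* The middle edge of a path on four vertices dominates: an edge [w z] violating this yields a
   longer path, or a 4-cycle when [z = v]. *)
have [|noP4] := boolP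
  [exists u : G, exists x : G, exists y : G, exists v : G,
    [&& edge u x, edge x y, edge y v, u != y & x != v]].
  case/existsP=> u /existsP[x /existsP[y /existsP[v]]].
  case/and5P=> ux xy yv nuy nxv; exists x, y.
  apply: closed_dominating_edge => // w z.
  wlog xw : u x y v ux xy yv nuy nxv / edge x w.
    move=> wl /orP[xw|yw]; first by apply: (wl u x y v); rewrite ?xw.
    rewrite setUC; apply: (wl v y x u); rewrite ?yw 1?edge_sym // eq_sym //.
  move=> _; rewrite !inE negb_or => /andP[nwx nwy] wz.
  have [//|nzx] := eqVneq z x; have [//|nzy /=] := eqVneq z y; exfalso.
  have [zv|nzv] := eqVneq z v; last first.
    by apply: (noP5 z w x y v); rewrite // edge_sym.
  apply: (noC4 w x y v) => //; first by rewrite edge_sym.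
  by rewrite -zv.
(* Without a path on four vertices, any edge dominates. *)
have /card_gt0P[x0 _] : 0 < #|G| by apply: leq_trans n5.
have [||x [y [xy _ _]]] := @connected_cut [set x0] conn.
- by apply/set0Pn; exists x0; rewrite set11.
- by apply/eqP=> e; move: n5; rewrite -cardsT -e cards1.
exists x, y; apply: closed_dominating_edge => // w z.
wlog xw : x y xy / edge x w.
  move=> wl /orP[xw|yw]; first by apply: (wl x y); rewrite ?xw.
  by rewrite setUC; apply: (wl y x); rewrite ?yw 1?edge_sym.
move=> _; rewrite !inE negb_or => /andP[nwx nwy] wz.
have [//|nzx] := eqVneq z x; have [//|nzy /=] := eqVneq z y; case/negP: noP4.
apply/existsP; exists y; apply/existsP; exists x; apply/existsP; exists w.
apply/existsP; exists z.
by rewrite xw wz edge_sym xy ![_ == w]eq_sym nwy eq_sym nzx.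
Qed.

(** * Adjacency and bipartition in the token graph *)

Section Fixed.
Variable k : nat.
Implicit Types A B : token_graph G k.

(** Both token sets have [k] elements, so exactly one end of the edge carries a token; otherwise one
    set would properly contain the other. *)
Lemma token_edge_slide A B : edge A B ->
  exists a b, cut (val A) a b /\ val B = slide (val A) a b.
Proof.
case/existsP=> a /existsP[b /andP[ab /eqP dAB]].
have eB : val B = slide (val A) a b.
  apply/setP=> t; rewrite in_slide.
  have /setP/(_ t) := dAB; rewrite /symdiff !inE => <-.
  by case: (t \in val A); case: (t \in val B).
exists a, b; split=> //; rewrite /cut ab /=; apply/eqP=> eq_ab.
have cA := eqP (valP A); have cB := eqP (valP B).
have ne : a != b by apply: contraTneq ab => ->; rewrite edge_irrefl.
have [Sa|Sa] := boolP (a \in val A).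
  have sB : val B \proper val A.
    apply/properP; split; last by exists a; rewrite // eB in_slide Sa eqxx.
    apply/subsetP=> t; rewrite eB in_slide.
    have [->|_] := eqVneq t a; first by rewrite Sa.
    have [->|_] := eqVneq t b; first by rewrite -eq_ab Sa.
    by rewrite addbF.
  by have := proper_card sB; rewrite cA cB ltnn.
have sB : val A \proper val B.
  apply/properP; split; last first.
    by exists a; rewrite // eB in_slide (negbTE Sa) eqxx.
  apply/subsetP=> t At; rewrite eB in_slide At.
  have [ta|_] := eqVneq t a; first by rewrite -ta At in Sa.
  by have [tb|_] := eqVneq t b; first by rewrite eq_ab -tb At in Sa.
by have := proper_card sB; rewrite cA cB ltnn.
Qed.

Lemma slide_token_edge A a b : cut (val A) a b ->
  exists2 B, edge A B & val B = slide (val A) a b.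
Proof.
move=> cab; have cB : #|slide (val A) a b| == k.
  by rewrite card_slide // (eqP (valP A)).
exists (exist (fun S : {set G} => #|S| == k) _ cB) => //=.
case/andP: cab => ab _; apply/existsP; exists a; apply/existsP; exists b.
rewrite ab /=; apply/eqP/setP=> t.
rewrite /symdiff /= in_setU !in_setD in_slide !inE.
by case: (t \in val A); case: (t == a); case: (t == b).
Qed.

(** Each move changes the number of tokens on the side [X] by one, so its parity splits the token
    graph. *)
Lemma token_graph_bipartition : bipartite G ->
  exists P : {set token_graph G k}, bipartition P.
Proof.
case/bipartite_bipartition=> X bX.
exists [set A : token_graph G k | odd #|val A :&: X|].
move=> A B /token_edge_slide[a0 [b0 [/cutP[a [b [ab Aa Ab e]]] eB]]].
rewrite !inE eB e slideE //.
have cA : #|val A :&: X| = (a \in X) + #|(val A :\ a) :&: X|.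
  by rewrite (cardsD1 a) !inE Aa setIDAC.
have cB : #|(b |: (val A :\ a)) :&: X| = (b \in X) + #|(val A :\ a) :&: X|.
  rewrite (cardsD1 b) !inE eqxx /= -setIDAC setU1K //.
  by rewrite !inE (negbTE Ab) andbF.
rewrite cA cB !oddD !oddb; have := bX a b ab.
by case: (a \in X); case: (b \in X); case: (odd #|_|).
Qed.

Lemma token_graph_no_isolated : connected_graph G -> 0 < k < #|G| ->
  forall A, exists B, edge A B.
Proof.
move=> conn /andP[k0 kn] A; have cA := eqP (valP A).
have [|| a [b [ab Aa Ab]]] := @connected_cut (val A) conn.
- by rewrite -card_gt0 cA.
- by apply/eqP=> e; move: kn; rewrite -cA e cardsT ltnn.
have [|B AB _] := @slide_token_edge A a b; last by exists B.
by rewrite /cut ab Aa (negbTE Ab).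
Qed.

(* The vertices on which the token sets slide S c d and slide (slide S a b) c' d'
   differ, whatever S is. *)
Definition slide_diff a b c d c' d' (t : G) : bool :=
  ((t == a) || (t == b)) (+) ((t == c) || (t == d)) (+) ((t == c') || (t == d')).

(** The move from [a] to [b] leads to the neighbour [B] given by [well_covered_joined_neighbour]. A
    neighbour of [S] and a neighbour of [B] are then adjacent, so they cannot differ at three
    vertices. *)
Lemma well_covered_close_slides S :
  connected_graph G -> bipartite G -> 0 < k < #|G| ->
  well_covered (token_graph G k) -> #|S| = k ->
  exists a b, [/\ edge a b, a \in S, b \notin S &
    forall c d c' d' p q r, cut S c d -> cut (slide S a b) c' d' ->
      uniq [:: p; q; r] -> ~~ all (slide_diff a b c d c' d') [:: p; q; r]].
Proof.
move=> conn bip kn wc cS.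
have [P bP] := token_graph_bipartition bip.
pose A : token_graph G k :=
  exist (fun S : {set G} => #|S| == k) S (introT eqP cS).
have [B AB joined] :=
  well_covered_joined_neighbour (token_graph_no_isolated conn kn) wc A bP.
have [a0 [b0 [/cutP[a [b [ab Aa Ab e]]] eB]]] := token_edge_slide AB.
exists a, b; split=> // c d c' d' p q r cd cd' uniq_pqr.
apply/negP=> /and4P[dp dq dr _].
have [C AC eC] := @slide_token_edge A c d cd.
have [D BD eD] : exists2 D, edge B D & val D = slide (slide S a b) c' d'.
  have [|D BD eD] := @slide_token_edge B c' d'; first by rewrite eB e.
  by exists D; rewrite // eD eB e.
have /existsP[x /existsP[y /andP[_ /eqP dDC]]] := joined D C BD AC.
have two t : slide_diff a b c d c' d' t -> t \in [:: x; y].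
  move=> dt; have /setP/(_ t) := dDC.
  rewrite /symdiff !inE eC eD !in_slide /= => <-; move: dt; rewrite /slide_diff.
  by do 3!case: (_ || _); case: (t \in S).
have : {subset [:: p; q; r] <= [:: x; y]}.
  by apply/allP; rewrite /= !two.
by move/(uniq_leq_size uniq_pqr).
Qed.


(** * Token sets that contradict well-coveredness *)

Lemma cut_slide S a b c d :
  c != a -> c != b -> d != a -> d != b -> cut (slide S a b) c d = cut S c d.
Proof.
move=> ca cb da db; rewrite /cut !in_slide.
by rewrite (negbTE ca) (negbTE cb) (negbTE da) (negbTE db) !addbF.
Qed.

Hypotheses (connG : connected_graph G) (bipG : bipartite G).
Hypothesis kn : 0 < k < #|G|.
Hypothesis wcT : well_covered (token_graph G k).

Lemma well_covered_no_cut_path S v1 v2 v3 v4 v5 : #|S| = k ->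
  uniq [:: v1; v2; v3; v4; v5] ->
  cut S v1 v2 -> cut S v2 v3 -> cut S v3 v4 -> cut S v4 v5 -> False.
Proof.
move=> cS u5 c12 c23 c34 c45.
have [a [b [ab Sa Sb far]]] := well_covered_close_slides connG bipG kn wcT cS.
(* [v2] and [v4] are both in [S] or both outside, while [a] and [b] are separated by [S]; hence at
   most one of [v2], [v4] is moved, and the path can be reversed. *)
wlog [v4a v4b] : v1 v2 v3 v4 v5 u5 c12 c23 c34 c45 / v4 != a /\ v4 != b.
  have n24 : v2 != v4.
    by apply: contraTneq u5 => ->; rewrite /= !inE eqxx ?orbT ?andbF.
  have e24 : (v2 \in S) = (v4 \in S).
    by move: c23 c34; rewrite /cut; do 3!case: (_ \in S); rewrite ?andbF.
  move=> wl.
  have [v4ab|/norP[v4a v4b]] := boolP ((v4 == a) || (v4 == b)); last first.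
    exact: (wl v1 v2 v3 v4 v5).
  apply: (wl v5 v4 v3 v2 v1); rewrite 1?cutC //; first by rewrite -rev_uniq.
  split; apply/eqP=> e; move: v4ab e24;
    rewrite -e [v4 == v2]eq_sym (negbTE n24) ?orbF /=.
    by rewrite e Sa => /eqP->; rewrite (negbTE Sb).
  by rewrite e (negbTE Sb) => /eqP->; rewrite Sa.
move: (u5); rewrite /= !inE !negb_or -!andbA andbT.
case/andP=> n12 /andP[n13 /andP[n14 /andP[n15 /andP[n23 /andP[n24]]]]].
case/andP=> n25 /andP[n34 /andP[n35 n45]].
have e35 : (v3 \in S) = (v5 \in S).
  by move: c34 c45; rewrite /cut; do 3!case: (_ \in S); rewrite ?andbF.
pose E := (eqxx, negbTE n34, negbTE n35, negbTE n45, negbTE v4a, negbTE v4b).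
have E' : ((v3 == v1) = false) * ((v3 == v2) = false) * ((v4 == v1) = false)
   * ((v4 == v2) = false) * ((v5 == v1) = false) * ((v5 == v2) = false)
   * ((v4 == v3) = false) * ((v5 == v3) = false) * ((v5 == v4) = false).
  by do !split; apply/negbTE; rewrite eq_sym.
have [v3ab|/norP[v3a v3b]] := boolP ((v3 == a) || (v3 == b)).
  have /norP[v5a v5b] : ~~ ((v5 == a) || (v5 == b)).
    apply/orP=> -[]/eqP e; move: v3ab e35; rewrite -e (negbTE n35) ?orbF /=.
      by rewrite e Sa => /eqP->; rewrite (negbTE Sb).
    by rewrite e (negbTE Sb) => /eqP->; rewrite Sa.
  have := far v1 v2 v4 v5 v3 v4 v5 c12; rewrite cut_slide // => /(_ c45).
  rewrite /= !inE /slide_diff v3ab.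
  by rewrite !(E, E', negbTE v5a, negbTE v5b) => /(_ isT).
have [v5ab|/norP[v5a v5b]] := boolP ((v5 == a) || (v5 == b)).
  have := far v1 v2 v3 v4 v3 v4 v5 c12; rewrite cut_slide // => /(_ c34).
  rewrite /= !inE /slide_diff v5ab.
  by rewrite !(E, E', negbTE v3a, negbTE v3b) => /(_ isT).
(* If none of [v3], [v4], [v5] is moved, the two moves share [v4], which cancels; [v3], [v5] and [a]
   remain. *)
have := far v4 v5 v3 v4 v3 v5 a c45; rewrite cut_slide // => /(_ c34).
rewrite /= !inE /slide_diff !(eq_sym a).
by rewrite !(E, E', negbTE v3a, negbTE v3b, negbTE v5a, negbTE v5b) => /(_ isT).
Qed.

Lemma leaf_adjacent x y w : dominating_edge x y -> w \notin [set x; y] ->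
  edge w x || edge w y.
Proof.
move=> [xy dom] nw.
have [||a [b [ab /set1P ea _]]] := @connected_cut [set w] connG.
- by apply/set0Pn; exists w; rewrite set11.
- apply/eqP=> /setP/(_ x); rewrite !inE => /eqP e.
  by rewrite -e set21 in nw.
have := dom a b ab; rewrite ea (negbTE nw) /= => /set2P[] e.
  by rewrite -ea -e ab.
by rewrite -ea -e ab orbT.
Qed.

(** The token at [a] moves to a centre, say [x]. The last hypothesis ensures a third token whenever
    [S] has leaves at both centres. *)
Lemma well_covered_no_leaf_set S x y : #|S| = k -> 1 < k ->
  dominating_edge x y -> S \subset ~: [set x; y] ->
  [\/ S \subset [set w | edge x w], S \subset [set w | edge y w] | 2 < k] ->
  False.
Proof.
move=> cS k1 dom sS cases.
have [a [b [ab Sa Sb far]]] := well_covered_close_slides connG bipG kn wcT cS.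
wlog bx : x y dom sS cases / b = x.
  move=> wl; have nb : b \in [set x; y].
    have := dom.2 _ _ ab; rewrite orbC; case: (b \in _) => //=.
    by have := subsetP sS a Sa; rewrite inE => /negbTE->.
  case/set2P: nb => e; first exact: (wl x y).
  apply: (wl y x) => //; [exact: dominating_edgeC | by rewrite setUC|].
  by case: cases; [constructor 2|constructor 1|constructor 3].
have notin z : z \in S -> z \notin [set x; y].
  by move/(subsetP sS); rewrite inE.
have Sx : x \notin S by apply/negP=> /notin; rewrite set21.
have Sy : y \notin S by apply/negP=> /notin; rewrite set22.
have ne z w : z \in S -> w \notin S -> (z == w) = false.
  by move=> Sz Sw; apply/negbTE; apply: contraNneq Sw => <-.
have xy := dom.1; subst b.
have cutS z w : z \in S -> w \notin S -> edge z w -> cut S z w.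
  by move=> Sz Sw zw; rewrite /cut zw Sz (negbTE Sw).
have tf z : edge z x -> ~~ edge z y.
  by move=> zx; apply: bipartite_triangle_free zx xy.
(* With a leaf [c] at [y], a third token [e] moves to its centre from [S], and [c] moves to [y]
   after the first move: the results differ at [a], [c] and [e]. *)
have [/existsP[c /andP[Sc cy]]|] := boolP [exists c in S, edge c y].
  have ca : c != a by apply: contraTneq cy => ->; apply: tf.
  have k3 : 2 < k.
    case: cases => // /subsetP sub.
    - have := sub c Sc; rewrite inE edge_sym => /tf; by rewrite cy.
    - have := sub a Sa; rewrite inE edge_sym; by rewrite (negbTE (tf _ ab)).
  have [e /setDP[Se]] : exists e, e \in S :\: [set a; c].
    apply/set0Pn; rewrite -card_gt0 cardsD cS subn_gt0.
    apply: leq_ltn_trans k3; apply: leq_trans (subset_leq_card (subsetIr _ _)) _.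
    by rewrite cards2; case: (a != c).
  rewrite !inE negb_or => /andP[ea ec].
  have ccy : cut (slide S a x) c y.
    rewrite cut_slide ?cutS //.
    - by rewrite ne.
    - by rewrite eq_sym ne.
    - by rewrite eq_sym edge_neq.
  case/orP: (leaf_adjacent dom (notin e Se)) => ew.
    have := far e x c y a c e (cutS e x Se Sx ew) ccy.
    rewrite /= !inE /slide_diff.
    rewrite !(eqxx, ne a x, ne a y, ne e x, ne e y, ne c x, ne c y) //.
    rewrite ![a == _]eq_sym ![c == e]eq_sym.
    by rewrite (negbTE ca) (negbTE ea) (negbTE ec) => /(_ isT).
  have := far e y c y a c e (cutS e y Se Sy ew) ccy.
  rewrite /= !inE /slide_diff.
  rewrite !(eqxx, ne a x, ne a y, ne e x, ne e y, ne c x, ne c y) //.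
  rewrite ![a == _]eq_sym ![c == e]eq_sym.
  by rewrite (negbTE ca) (negbTE ea) (negbTE ec) => /(_ isT).
rewrite negb_exists => /forallP none.
(* All leaves in [S] hang at [x]: moving [c] to [x] from [S], and [x] to [y] after the first move,
   gives a difference at [a], [c] and [y]. *)
have [c /setD1P[ca Sc]] : exists c, c \in S :\ a.
  by apply/set0Pn; rewrite -card_gt0; have := cardsD1 a S; rewrite Sa cS; lia.
have cx : edge c x.
  case/orP: (leaf_adjacent dom (notin c Sc)) => // cy.
  by have := none c; rewrite Sc cy.
have nyx : (y == x) = false by rewrite eq_sym; apply/negbTE/edge_neq.
have cxy : cut (slide S a x) x y.
  rewrite /cut !in_slide xy (negbTE Sx) (negbTE Sy) nyx [y == a]eq_sym (ne a) //.
  by rewrite eqxx orbT.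
have := far c x x y a c y (cutS c x Sc Sx cx) cxy.
rewrite /= !inE /slide_diff ![y == a]eq_sym ![y == c]eq_sym.
rewrite !(eqxx, ne a x, ne a y, ne c x, ne c y) //.
by rewrite ![a == c]eq_sym (negbTE ca) nyx /= => /(_ isT).
Qed.

End Fixed.
End Token.

(** * Choice of the token set *)

Theorem theorem4p9 (G : sgraph) (k : nat) :
  connected_graph G -> bipartite G -> 5 <= #|G| ->
  2 <= k <= uphalf #|G| ->
  ~ well_covered (token_graph G k).
Proof.
move=> conn bip n5 /andP[k2 kn] wc.
have {kn} kn2 : k + 2 <= #|G| by lia.
have kn : 0 < k < #|G| by lia.
case: (path5_or_dominating_edge conn bip n5).
  case=> v1 [v2 [v3 [v4 [v5 [u5 [e12 e23 e34 e45]]]]]].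
  move: (u5); rewrite /= !inE !negb_or -!andbA andbT.
  case/andP=> n12 /andP[n13 /andP[n14 /andP[n15 /andP[n23 /andP[n24]]]]].
  case/andP=> n25 /andP[n34 /andP[n35 n45]].
  have dis : [disjoint [set v2; v4] & [set v1; v3; v5]].
    rewrite disjoints_subset; apply/subsetP=> z /set2P[]->; rewrite !inE !negb_or.
      by rewrite eq_sym n12 n23 n25.
    by rewrite eq_sym n14 eq_sym n34 n45.
  have c2 : #|[set v2; v4]| = 2 by rewrite cards2 n24.
  have c3 : #|[set v1; v3; v5]| = 3.
    by rewrite setUC cardsU1 !inE negb_or cards2 n13 ![v5 == _]eq_sym n15 n35.
  (* If [k + 3 <= #|G|], tokens go on [v2], [v4] and not on the others. Otherwise [#|G| >= 5] forces
     [k >= 3], and the roles are exchanged. *)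
  have [S cS sep] : exists2 S : {set G}, #|S| = k &
      [&& (v1 \in S) != (v2 \in S), (v2 \in S) != (v3 \in S),
          (v3 \in S) != (v4 \in S) & (v4 \in S) != (v5 \in S)].
    have [k3|k3] := leqP (k + 3) #|G|.
      have [||S cS [in2 out3]] := exists_separating_set_card (k := k) dis.
      - by rewrite c2.
      - by rewrite c3.
      exists S; rewrite // (in2 v2) ?(in2 v4) ?set21 ?set22 //.
      rewrite (negbTE (out3 v1 _)) ?(negbTE (out3 v3 _)) ?(negbTE (out3 v5 _)) //;
        by rewrite !inE eqxx ?orbT.
    rewrite disjoint_sym in dis.
    have [||S cS [in3 out2]] := exists_separating_set_card (k := k) dis.
    - by rewrite c3 -(ltn_add2r 3); apply: leq_ltn_trans n5 k3.
    - by rewrite c2.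
    exists S; rewrite // (negbTE (out2 v2 _)) ?(negbTE (out2 v4 _)) ?set21 ?set22 //.
    by rewrite (in3 v1) ?(in3 v3) ?(in3 v5) // !inE eqxx ?orbT.
  case/and4P: sep => s12 s23 s34 s45.
  by apply: (well_covered_no_cut_path conn bip kn wc cS u5);
    rewrite /cut ?e12 ?e23 ?e34 ?e45.
case=> x [y dom].
have nxy : x != y := edge_neq dom.1.
have cxy : #|[set x; y]| = 2 by rewrite cards2 nxy.
have cL : #|~: [set x; y]| + 2 = #|G| by have := cardsC [set x; y]; lia.
have [k3|k3] := leqP 3 k.
  have [|S [_ sS cS]] := @exists_subset_card G set0 (~: [set x; y]) k (sub0set _).
    by rewrite cards0; lia.
  by apply: (well_covered_no_leaf_set conn bip kn wc cS k2 dom sS); constructor 3.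
(* Here [k = 2], and the [#|G| - 2 >= 3] leaves put at least two at the same centre. *)
wlog cX : x y dom nxy cxy cL / 1 < #|~: [set x; y] :&: [set w | edge x w]|.
  move=> wl; have [cX|cX] := leqP 2 #|~: [set x; y] :&: [set w | edge x w]|.
    exact: (wl x y).
  apply: (wl y x); rewrite ?[[set y; x]]setUC //.
  - exact: dominating_edgeC.
  - by rewrite eq_sym.
  have cover : ~: [set x; y] \subset (~: [set x; y] :&: [set w | edge x w])
      :|: (~: [set x; y] :&: [set w | edge y w]).
    apply/subsetP=> w; rewrite -setIUr inE => nw; rewrite !inE -in_set2 nw.
    by rewrite (edge_sym x) (edge_sym y); apply: (leaf_adjacent conn dom).
  have := leq_trans (subset_leq_card cover) (leq_card_setU _ _); lia.
have [|S [_ /subsetIP[sS sX] cS]] :=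
    @exists_subset_card G set0 (~: [set x; y] :&: [set w | edge x w]) k (sub0set _).
  by rewrite cards0; lia.
by apply: (well_covered_no_leaf_set conn bip kn wc cS k2 dom sS); constructor 1.
Qed.
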